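(* Let $\mathbb{K}$ be an algebraically closed field and let $(A,\lambda)$ be a semisimple symmetric Frobenius $\mathbb{K}$-algebra. Then the category $(A\text{-}\mathrm{Mod})^{\mathrm{fg}}$ of finitely generated left $A$-modules, together with the maps $\mathrm{tr}^\lambda_M:\mathrm{End}_A(M)\to\mathbb{K}$ given for each finitely generated left $A$-module $M$ by the composition $$\mathrm{tr}_M^\lambda:\ \mathrm{End}_A(M)\xrightarrow{\Psi_{M,M}^{-1}}M^*\otimes_AM\xrightarrow{\mathrm{ev}}A\xrightarrow{\lambda}\mathbb{K},$$ is a Calabi-Yau category.
   Context: All algebras are finite-dimensional associative unital algebras over the algebraically closed field $\mathbb{K}$. A Frobenius algebra $(A,\lambda)$ is an algebra $A$ with a linear map $\lambda:A\to\mathbb{K}$ such that the pairing $a\otimes b\mapsto\lambda(ab)$ is non-degenerate. It is symmetric if $\lambda(ab)=\lambda(ba)$ for all $a,b\in A$. For a left $A$-module $M$, $M^*:=\mathrm{Hom}_A(M,A)$ is a right $A$-module via $(f.a)(m):=f(m)a$. The map $\Psi_{M,M}:M^*\otimes_AM\to\mathrm{End}_A(M)$ is $f\otimes m\mapsto(x\mapsto f(x).m)$; it is an isomorphism when $A$ is semisimple and $M$ is finitely generated. The map $\mathrm{ev}:M^*\otimes_AM\to A$ is $f\otimes m\mapsto f(m)$. A linear category is an abelian category with a compatible enrichment over $\mathbb{K}$-vector spaces. It is finite if it has only finitely many isomorphism classes of simple objects, has enough projectives, every object has finite length, and all Hom-spaces are finite-dimensional. A Calabi-Yau category $(\mathcal{C},\mathrm{tr}^{\mathcal{C}})$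 is a linear, finite, semisimple category $\mathcal{C}$ with a family of linear maps $\mathrm{tr}_c^{\mathcal{C}}:\mathrm{End}_{\mathcal{C}}(c)\to\mathbb{K}$, one for each object $c$, such that (i) $\mathrm{tr}^{\mathcal{C}}_c(g\circ f)=\mathrm{tr}^{\mathcal{C}}_d(f\circ g)$ for all $f\in\mathrm{Hom}_{\mathcal{C}}(c,d)$, $g\in\mathrm{Hom}_{\mathcal{C}}(d,c)$; and (ii) for all objects $c,d$ the pairing $\mathrm{Hom}_{\mathcal{C}}(c,d)\otimes_{\mathbb{K}}\mathrm{Hom}_{\mathcal{C}}(d,c)\to\mathbb{K}$, $f\otimes g\mapsto\mathrm{tr}^{\mathcal{C}}_c(g\circ f)$, is non-degenerate.
   Formalization: The evaluation M^*⊗_A M → A, f⊗m ↦ f(m), is well defined only modulo commutators of A (it fails for A = M_2(K)); it is computed on a chosen representative of the tensor, and for symmetric λ the composite λ∘ev does not depend on this choice. *)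

(* Defs.v *)
From HB Require Import structures.
From mathcomp Require Import all_boot all_order all_algebra.
From mathcomp Require Import boolp functions.
From mathcomp Require Import classical_sets.
From mathcomp.multinomials Require Import freeg.

Set Implicit Arguments.
Unset Strict Implicit.
Unset Printing Implicit Defensive.

Import GRing.Theory.
Local Open Scope ring_scope.

(* A unital associative K-algebra, as a ring with a central morphism from K.
   MathComp's [algType] is not used because it requires [1 != 0], which would
   exclude the zero algebra. *)
Record unital_alg (K : pzRingType) := UnitalAlg {
  alg_ring :> pzRingType;
  alg_in : {rmorphism K -> alg_ring};
  alg_inC : forall k a, alg_in k * a = a * alg_in k
}.

Arguments alg_in {K} _.

(* [A] as a left module over [K]; the regular left [A]-module is [A^o]. *)
Definition vect_of (K : pzRingType) (A : unital_alg K) : Type := A.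

Section VectOf.
Variables (K : pzRingType) (A : unital_alg K).

HB.instance Definition _ := GRing.Zmodule.copy (vect_of A) A.

Definition alg_scale (k : K) (v : vect_of A) : vect_of A :=
  alg_in A k * (v : A).

Fact alg_scaleA k l v : alg_scale k (alg_scale l v) = alg_scale (k * l) v.
Proof. by rewrite /alg_scale rmorphM mulrA. Qed.
Fact alg_scale1 : left_id 1 alg_scale.
Proof. by move=> v; rewrite /alg_scale rmorph1 mul1r. Qed.
Fact alg_scaleDr : right_distributive alg_scale +%R.
Proof. by move=> k u v; rewrite /alg_scale -mulrDr. Qed.
Fact alg_scaleDl v : {morph alg_scale^~ v : k l / k + l}.
Proof. by move=> k l; rewrite /alg_scale rmorphD mulrDl. Qed.

HB.instance Definition _ := GRing.Zmodule_isLmodule.Build K (vect_of A)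
  alg_scaleA alg_scale1 alg_scaleDr alg_scaleDl.

End VectOf.

Definition fin_gen (R : pzRingType) (V : lmodType R) : Prop :=
  exists s : seq V, forall v,
    exists c : 'I_(size s) -> R, v = \sum_i c i *: s`_i.

Definition simple_submod (R : pzRingType) (V : lmodType R)
    (S : {pred V}) : Prop :=
  [/\ GRing.submod_closed S, (exists2 x, x \in S & x != 0) &
    forall T : {pred V}, GRing.submod_closed T -> {subset T <= S} ->
      T =i pred1 0 \/ T =i S].

(* [V] is the internal direct sum of finitely many simple submodules. *)
Definition semisimple_mod (R : pzRingType) (V : lmodType R) : Prop :=
  exists n (S : 'I_n -> {pred V}), (forall i, simple_submod (S i)) /\
    forall v, exists! c : {ffun 'I_n -> V},
      (forall i, c i \in S i) /\ v = \sum_i c i.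

Definition semisimple_alg (K : pzRingType) (A : unital_alg K) : Prop :=
  semisimple_mod A^o.

Definition nondegenerate_pairing (K : pzRingType) (V W : zmodType)
    (b : V -> W -> K) : Prop :=
  (forall v, (forall w, b v w = 0) -> v = 0) /\
  (forall w, (forall v, b v w = 0) -> w = 0).

Definition is_frobenius_form (K : pzRingType) (A : unital_alg K)
  (lam : {scalar (vect_of A)}) : Prop :=
  nondegenerate_pairing (fun a b : A => lam (a * b)).

Definition is_symmetric_form (K : pzRingType) (A : unital_alg K)
  (lam : {scalar (vect_of A)}) : Prop :=
  forall a b : A, lam (a * b) = lam (b * a).

Record enriched_cat (K : pzRingType) := EnrichedCat {
  cobj :> Type;
  chom : cobj -> cobj -> lmodType K;
  cidm : forall c, chom c c;
  ccomp : forall a b c, chom b c -> chom a b -> chom a c;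
  comp_linearl : forall a b c (f : chom a b),
    linear (fun g : chom b c => ccomp g f);
  comp_linearr : forall a b c (g : chom b c),
    linear (fun f : chom a b => ccomp g f);
  ccompA : forall a b c d (h : chom c d) (g : chom b c) (f : chom a b),
    ccomp h (ccomp g f) = ccomp (ccomp h g) f;
  ccomp1m : forall a b (f : chom a b), ccomp (cidm b) f = f;
  ccompm1 : forall a b (f : chom a b), ccomp f (cidm a) = f
}.

Arguments chom {K e} _ _.
Arguments cidm {K e} _.
Arguments ccomp {K e a b c} _ _.

Notation "g \oC f" := (ccomp g f)
  (at level 50, left associativity, format "g  \oC  f").

Section Category.
Variables (K : pzRingType) (C : enriched_cat K).
Implicit Types a b c d s : C.

Definition is_mono b c (f : chom b c) : Prop :=
  forall a (g h : chom a b), f \oC g = f \oC h -> g = h.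

Definition is_epi b c (f : chom b c) : Prop :=
  forall d (g h : chom c d), g \oC f = h \oC f -> g = h.

Definition is_iso b c (f : chom b c) : Prop :=
  exists g : chom c b, g \oC f = cidm b /\ f \oC g = cidm c.

Definition isomorphic b c : Prop := exists f : chom b c, is_iso f.

Definition is_zero_obj z : Prop :=
  forall c, (forall f : chom z c, f = 0) /\ (forall f : chom c z, f = 0).

(* [c] is a biproduct of the finite family [S]; for [n = 0] this says that
   [c] is a zero object. *)
Definition is_direct_sum n (S : 'I_n -> C) c : Prop :=
  exists (inj : forall i, chom (S i) c) (proj : forall i, chom c (S i)),
    [/\ forall i, proj i \oC inj i = cidm (S i),
        forall i j, i != j -> proj j \oC inj i = 0 &
        \sum_i (inj i \oC proj i) = cidm c].

Definition is_kernel k b c (f : chom b c) (i : chom k b) : Prop :=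
  f \oC i = 0 /\
  forall a (g : chom a b), f \oC g = 0 -> exists! h : chom a k, i \oC h = g.

Definition is_cokernel b c q (f : chom b c) (p : chom c q) : Prop :=
  p \oC f = 0 /\
  forall d (g : chom c d), g \oC f = 0 -> exists! h : chom q d, h \oC p = g.

Record abelian_cat : Prop := AbelianCat {
  abelian_sums : forall n (S : 'I_n -> C), exists c, is_direct_sum S c;
  abelian_ker : forall b c (f : chom b c),
    exists k (i : chom k b), is_kernel f i;
  abelian_coker : forall b c (f : chom b c),
    exists q (p : chom c q), is_cokernel f p;
  abelian_mono : forall k b (i : chom k b), is_mono i ->
    exists c (f : chom b c), is_kernel f i;
  abelian_epi : forall c q (p : chom c q), is_epi p ->
    exists b (f : chom b c), is_cokernel f p
}.

Definition is_simple s : Prop :=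
  ~ is_zero_obj s /\
  forall d (f : chom d s), is_mono f -> is_zero_obj d \/ is_iso f.

Definition is_projective p : Prop :=
  forall b c (e : chom b c) (f : chom p c), is_epi e ->
    exists g : chom p b, e \oC g = f.

(* [c] has a composition series: a finite filtration starting at a zero object
   whose successive quotients are simple. *)
Inductive finite_length : C -> Prop :=
  | finite_length0 c : is_zero_obj c -> finite_length c
  | finite_lengthS c' c s (i : chom c' c) (p : chom c s) :
      finite_length c' -> is_mono i -> is_cokernel i p -> is_simple s ->
      finite_length c.

Record finite_cat : Prop := FiniteCat {
  finite_simples : exists n (S : 'I_n -> C),
    forall s, is_simple s -> exists i, isomorphic s (S i);
  finite_enough_projectives : forall c,
    exists p (e : chom p c), is_projective p /\ is_epi e;
  finite_lengths : forall c, finite_length c;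
  finite_homs : forall b c, fin_gen (chom b c)
}.

Definition semisimple_cat : Prop :=
  forall c, exists n (S : 'I_n -> C),
    (forall i, is_simple (S i)) /\ is_direct_sum S c.

Record calabi_yau (tr : forall c : C, chom c c -> K) : Prop := CalabiYau {
  cy_abelian : abelian_cat;
  cy_finite : finite_cat;
  cy_semisimple : semisimple_cat;
  cy_linear : forall c, scalar (tr c);
  cy_cyclic : forall c d (f : chom c d) (g : chom d c),
    tr c (g \oC f) = tr d (f \oC g);
  cy_nondegenerate : forall c d,
    nondegenerate_pairing (fun (f : chom c d) (g : chom d c) => tr c (g \oC f))
}.

End Category.

Section Hom.
Variables (K : comPzRingType) (A : unital_alg K).

(* A wrapper around [{linear M -> N}], so that [Hom M N] can be given its own
   algebraic structures. *)
Record Hom (M N : lmodType A) : Type := LinHom {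
  lin_of_Hom :> {linear M -> N}
}.

Section HomZmod.
Variables M N : lmodType A.

Lemma HomP (f g : Hom M N) : (forall x, f x = g x) -> f = g.
Proof.
case: f g => [[f cf]] [[g cg]] /= /funext efg; congr LinHom.
case: g / efg cg => -[[ag] [sg]]; case: cf => -[af] [sf].
by rewrite (Prop_irrelevance af ag) (Prop_irrelevance sf sg).
Qed.

Definition mkHom (f : M -> N) (lin_f : linear f) : Hom M N :=
  LinHom (HB.pack f (GRing.isLinear.Build A M N *:%R f lin_f)).

Lemma mkHomE f lin_f x : @mkHom f lin_f x = f x. Proof. by []. Qed.

Lemma Hom_linear (f : Hom M N) : linear f.
Proof. exact: linearP. Qed.

HB.instance Definition _ := gen_eqMixin (Hom M N).
HB.instance Definition _ := gen_choiceMixin (Hom M N).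

Lemma Hom0_linear : linear (fun _ : M => 0 : N).
Proof. by move=> a x y; rewrite scaler0 addr0. Qed.

Lemma HomN_linear (f : Hom M N) : linear (fun x => - f x).
Proof. by move=> a x y; rewrite Hom_linear opprD scalerN. Qed.

Lemma HomD_linear (f g : Hom M N) : linear (fun x => f x + g x).
Proof. by move=> a x y; rewrite !Hom_linear scalerDr addrACA. Qed.

Lemma HomZ_linear (k : K) (f : Hom M N) : linear (fun x => alg_in A k *: f x).
Proof.
by move=> a x y; rewrite Hom_linear scalerDr !scalerA alg_inC.
Qed.

Definition Hom0 := mkHom Hom0_linear.
Definition HomN f := mkHom (HomN_linear f).
Definition HomD f g := mkHom (HomD_linear f g).
Definition HomZ k f := mkHom (HomZ_linear k f).

Fact HomDA : associative HomD.
Proof. by move=> f g h; apply: HomP => x; rewrite !mkHomE addrA. Qed.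
Fact HomDC : commutative HomD.
Proof. by move=> f g; apply: HomP => x; rewrite !mkHomE addrC. Qed.
Fact Hom0D : left_id Hom0 HomD.
Proof. by move=> f; apply: HomP => x; rewrite !mkHomE add0r. Qed.
Fact HomND : left_inverse Hom0 HomN HomD.
Proof. by move=> f; apply: HomP => x; rewrite !mkHomE addNr. Qed.

HB.instance Definition _ :=
  GRing.isZmodule.Build (Hom M N) HomDA HomDC Hom0D HomND.

Fact HomZA k l f : HomZ k (HomZ l f) = HomZ (k * l) f.
Proof.
by apply: HomP => x; rewrite !mkHomE scalerA rmorphM.
Qed.
Fact Hom1Z : left_id 1 HomZ.
Proof. by move=> f; apply: HomP => x; rewrite mkHomE rmorph1 scale1r. Qed.
Fact HomZDr : right_distributive HomZ +%R.
Proof. by move=> k f g; apply: HomP => x; rewrite !mkHomE scalerDr. Qed.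
Fact HomZDl f : {morph HomZ^~ f : k l / k + l}.
Proof. by move=> k l; apply: HomP => x; rewrite !mkHomE rmorphD scalerDl. Qed.

HB.instance Definition _ :=
  GRing.Zmodule_isLmodule.Build K (Hom M N) HomZA Hom1Z HomZDr HomZDl.

End HomZmod.

Lemma Hom_id_linear (M : lmodType A) : linear (@id M).
Proof. by []. Qed.

Lemma Hom_comp_linear (L M N : lmodType A) (g : Hom M N) (f : Hom L M) :
  linear (fun x => g (f x)).
Proof. by move=> a x y; rewrite !Hom_linear. Qed.

Definition Hom_id (M : lmodType A) : Hom M M := mkHom (@Hom_id_linear M).
Definition Hom_comp (L M N : lmodType A) (g : Hom M N) (f : Hom L M) :
  Hom L N := mkHom (Hom_comp_linear g f).

Record fgmod := FgMod {
  fgmod_car :> lmodType A;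
  fgmodP : fin_gen fgmod_car
}.

Fact fgmod_comp_linearl (L M N : fgmod) (f : Hom L M) :
  linear (fun g : Hom M N => Hom_comp g f).
Proof. by move=> k g h; apply: HomP. Qed.
Fact fgmod_comp_linearr (L M N : fgmod) (g : Hom M N) :
  linear (fun f : Hom L M => Hom_comp g f).
Proof. by move=> k f h; apply: HomP => x; rewrite !mkHomE Hom_linear. Qed.
Fact fgmod_compA (L M N P : fgmod)
    (h : Hom N P) (g : Hom M N) (f : Hom L M) :
  Hom_comp h (Hom_comp g f) = Hom_comp (Hom_comp h g) f.
Proof. exact: HomP. Qed.
Fact fgmod_comp1m (M N : fgmod) (f : Hom M N) : Hom_comp (Hom_id N) f = f.
Proof. exact: HomP. Qed.
Fact fgmod_compm1 (M N : fgmod) (f : Hom M N) : Hom_comp f (Hom_id M) = f.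
Proof. exact: HomP. Qed.

Definition fgmod_cat : enriched_cat K :=
  @EnrichedCat K fgmod (fun M N => Hom M N) (fun M => Hom_id M)
    (fun L M N g f => Hom_comp g f) fgmod_comp_linearl fgmod_comp_linearr
    fgmod_compA fgmod_comp1m fgmod_compm1.

(* Right A-modules are left modules over the converse ring [A^c]. *)
Definition dual (M : lmodType A) : Type := Hom M A^o.

Section Dual.
Variable M : lmodType A.

HB.instance Definition _ := GRing.Zmodule.copy (dual M) (Hom M A^o).

Lemma dualP (f g : dual M) : (forall x, f x = g x) -> f = g.
Proof. exact: (@HomP M A^o). Qed.

Lemma dual_act_linear (a : A) (f : dual M) :
  linear (fun x => f x * a : A^o).
Proof.
by move=> b x y; rewrite linearP mulrDl; congr (_ + _); rewrite -mulrA.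
Qed.

Definition dual_act (a : A^c) (f : dual M) : dual M :=
  mkHom (dual_act_linear a f).

Lemma dual_actE a f x : dual_act a f x = f x * (a : A).
Proof. by []. Qed.

Fact dual_actA a b f : dual_act a (dual_act b f) = dual_act (a * b) f.
Proof. by apply: dualP => x; rewrite !dual_actE mulrA. Qed.
Fact dual_act1 : left_id 1 dual_act.
Proof. by move=> f; apply: dualP => x; rewrite dual_actE mulr1. Qed.
Fact dual_actDr : right_distributive dual_act +%R.
Proof. by move=> a f g; apply: dualP => x; rewrite dual_actE mulrDl. Qed.
Fact dual_actDl f : {morph dual_act^~ f : a b / a + b}.
Proof. by move=> a b; apply: dualP => x; rewrite dual_actE mulrDr. Qed.

HB.instance Definition _ := GRing.Zmodule_isLmodule.Build A^c (dual M)
  dual_actA dual_act1 dual_actDr dual_actDl.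

Lemma dual_scaleE (a : A^c) (f : dual M) x : (a *: f) x = f x * (a : A).
Proof. by []. Qed.

End Dual.
End Hom.

Section Tensor.
Variables (R : pzRingType) (P : lmodType R^c) (M : lmodType R).

Local Notation free := {freeg (P * M)%type / int}.

Inductive tensor_rel : free -> Prop :=
  | tensor_rel0 : tensor_rel 0
  | tensor_relB x y : tensor_rel x -> tensor_rel y -> tensor_rel (x - y)
  | tensor_relDl p q m :
      tensor_rel (<< (p + q, m) >> - (<< (p, m) >> + << (q, m) >>))
  | tensor_relDr p m n :
      tensor_rel (<< (p, m + n) >> - (<< (p, m) >> + << (p, n) >>))
  | tensor_relA (p : P) (a : R) (m : M) :
      tensor_rel (<< ((a : R^c) *: p, m) >> - << (p, a *: m) >>).

Definition tensor_relb : {pred free} := fun x => `[< tensor_rel x >].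

Fact tensor_relb_closed : zmod_closed tensor_relb.
Proof.
split=> [|x y /asboolP rx /asboolP ry]; apply/asboolP; first exact: tensor_rel0.
exact: tensor_relB.
Qed.

HB.instance Definition _ :=
  GRing.isZmodClosed.Build free tensor_relb tensor_relb_closed.

Definition tensor : Type := Quotient.quot tensor_relb.

HB.instance Definition _ := GRing.Zmodule.on tensor.

Definition to_tensor (x : free) : tensor :=
  (\pi_(Quotient.quot tensor_relb) x)%qT.

Definition tens (p : P) (m : M) : tensor := to_tensor << (p, m) >>.

(* The additive extension of [b] to formal sums. *)
Definition free_lift (V : zmodType) (b : P -> M -> V) (x : free) : V :=
  \sum_(pm <- dom x) b pm.1 pm.2 *~ coeff pm x.

(* [free_lift b] evaluated at some representative; this is the map induced by
   [b] when [b] is balanced. *)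
Definition tensor_lift (V : zmodType) (b : P -> M -> V) (t : tensor) : V :=
  free_lift b (repr t).

Definition balanced (V : zmodType) (b : P -> M -> V) : Prop :=
  [/\ forall p q m, b (p + q) m = b p m + b q m,
      forall p m n, b p (m + n) = b p m + b p n &
      forall p (a : R) m, b ((a : R^c) *: p) m = b p (a *: m)].

Section Lift.
Variables (V : zmodType) (b : P -> M -> V).

Let b' (pm : P * M) : zmodule V := b pm.1 pm.2.

HB.instance Definition _ := GRing.isZmodMorphism.Build free (zmodule V)
  (fglift b') (lift_is_additive b').

Lemma free_liftE x : free_lift b x = fglift b' x.
Proof.
rewrite -[x in RHS]freeg_sumE raddf_sum; apply: eq_bigr => pm _.
by rewrite [RHS]liftU.
Qed.

Lemma free_liftB x y : free_lift b (x - y) = free_lift b x - free_lift b y.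
Proof. by rewrite !free_liftE raddfB. Qed.

Lemma free_liftD x y : free_lift b (x + y) = free_lift b x + free_lift b y.
Proof. by rewrite !free_liftE raddfD. Qed.

Lemma free_liftU p m : free_lift b << (p, m) >> = b p m.
Proof. by rewrite free_liftE liftU scale1r. Qed.

Lemma free_lift_rel x : balanced b -> tensor_rel x -> free_lift b x = 0.
Proof.
move=> [bDl bDr bA]; elim=> [|{}x y _ x0 _ y0|p q m|p m n|p a m].
- by rewrite free_liftE raddf0.
- by rewrite free_liftB x0 y0 subrr.
- by rewrite free_liftB free_liftD !free_liftU bDl subrr.
- by rewrite free_liftB free_liftD !free_liftU bDr subrr.
- by rewrite free_liftB !free_liftU bA subrr.
Qed.

Lemma tensor_lift_pi x :
  balanced b -> tensor_lift b (to_tensor x) = free_lift b x.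
Proof.
move=> bb; apply/eqP; rewrite -subr_eq0 /tensor_lift -free_liftB.
apply/eqP/free_lift_rel => //; apply/asboolP.
by rewrite -[`[< _ >]]/(_ \in tensor_relb) Quotient.idealrBE reprK.
Qed.

Lemma tensor_lift_tens p m : balanced b -> tensor_lift b (tens p m) = b p m.
Proof. by move=> bb; rewrite tensor_lift_pi // free_liftU. Qed.

End Lift.
End Tensor.

Section Trace.
Variables (K : comPzRingType) (A : unital_alg K).
Variable M : lmodType A.

Lemma rank1_linear (f : dual M) (m : M) : linear (fun x => (f x : A) *: m).
Proof. by move=> a x y; rewrite linearP scalerDl scalerA. Qed.

Definition rank1_Hom (f : dual M) (m : M) : Hom M M := mkHom (rank1_linear f m).

Lemma rank1_balanced : balanced rank1_Hom.
Proof.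
split=> [f g m|f m n|f a m]; apply: HomP => x; rewrite /rank1_Hom.
- exact: scalerDl.
- exact: scalerDr.
- by rewrite !mkHomE scalerA.
Qed.

Definition Psi : tensor (dual M) M -> Hom M M := tensor_lift rank1_Hom.

Lemma Psi_tens f m : Psi (tens f m) = rank1_Hom f m.
Proof. exact: tensor_lift_tens rank1_balanced. Qed.

(* The two-sided inverse of [Psi] whenever [Psi] is bijective, in particular
   when [A] is semisimple and [M] is finitely generated. *)
Definition Psi_inv : Hom M M -> tensor (dual M) M :=
  'pinv_(fun=> 0) setT Psi.

(* The evaluation [f (x) m |-> f m] is balanced only modulo commutators of [A],
   so that [ev t] depends on a choice of representative of [t]; by
   [form_ev_tens] its image under a symmetric form does not. *)
Definition ev : tensor (dual M) M -> A :=
  tensor_lift (fun (f : dual M) (m : M) => f m : A).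

Variable lam : {scalar (vect_of A)}.

Definition trace (f : Hom M M) : K := lam (ev (Psi_inv f)).

Lemma form_evE t : lam (ev t) = tensor_lift (fun (f : dual M) m => lam (f m)) t.
Proof.
rewrite /ev /tensor_lift /free_lift raddf_sum.
by apply: eq_bigr => fm _; rewrite raddfMz.
Qed.

Lemma form_eval_balanced :
  is_symmetric_form lam -> balanced (fun (f : dual M) m => lam (f m)).
Proof.
move=> lamC; split=> [f g m|f m n|f a m].
- exact: raddfD.
- by rewrite !raddfD.
- by rewrite dual_scaleE lamC; rewrite linearZ.
Qed.

Lemma form_ev_tens f m :
  is_symmetric_form lam -> lam (ev (tens f m)) = lam (f m).
Proof.
by move=> lamC; rewrite form_evE tensor_lift_tens //; apply: form_eval_balanced.
Qed.

End Trace.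

(* Main.v *)
From HB Require Import structures.
From mathcomp.multinomials Require Import freeg.
From mathcomp Require Import all_boot all_order all_algebra.
From mathcomp Require Import boolp functions classical_sets.
Require Import Defs.

(** Everything rests on one property of the category: every morphism [f] is
    von Neumann regular, that is, [f h f = f] for some [h] ([fgmod_regular]).
    Indeed, a submodule [N] of a finitely generated module over a semisimple
    algebra has a complement ([complement]): the module is a finite sum of
    homomorphic images of simple left ideals, each of which is either
    contained in, or independent from, what has been built so far. Projecting
    onto the kernel and onto the image of [f] then yields [h].

    In a category with regular morphisms, split idempotents and biproducts,
    [1 - h f] and [1 - f h] are idempotents whose splittings are a kernel and
    a cokernel of [f], every monomorphism and every epimorphism splits, and
    hence the category is abelian and all its objects are projective
    ([regular_abelian], [regular_projective]). If moreover finitely many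
    simple objects generate, in the sense that finitely many morphisms from
    them are jointly epic on any given object, then a nonzero morphism from a
    simple object splits off a summand, and induction on the number of
    generating morphisms decomposes every object into simple ones
    ([spanned_ind]). For modules, the simple left ideals in a decomposition of
    [A] are such generators ([simple_generators]).

    Projectivity also provides a finite dual basis [m j], [phi j] of each
    module ([dual_basis]). It gives the surjectivity of [Psi] and the formula
    [trace f = \sum_j lam (phi j (f (m j)))] ([trace_dual_basis]), by
    additivity and a check on elementary tensors that uses the symmetry of
    [lam]. Linearity of the trace is then visible, and cyclicity follows by
    expanding in two dual bases and exchanging the sums. Nondegeneracy reduces
    to that of [lam], as the trace of the rank one endomorphism
    [x |-> g x *: y] is [lam (g y)]. *)

Set Implicit Arguments.
Unset Strict Implicit.
Unset Printing Implicit Defensive.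

Import GRing.Theory.
Local Open Scope ring_scope.

(** * Categories enriched in modules *)

Section Preadditive.
Variables (K : pzRingType) (C : enriched_cat K).
Implicit Types a b c d s z : C.

(** Named so that composition in one variable carries a canonical linear
    structure. *)
Definition precomp a b c (f : chom a b) (g : chom b c) := g \oC f.
Definition postcomp a b c (g : chom b c) (f : chom a b) := g \oC f.

HB.instance Definition _ a b c (f : chom a b) :=
  GRing.isLinear.Build K (chom b c) (chom a c) *:%R (@precomp a b c f)
    (comp_linearl f).
HB.instance Definition _ a b c (g : chom b c) :=
  GRing.isLinear.Build K (chom a b) (chom a c) *:%R (@postcomp a b c g)
    (comp_linearr g).

Lemma comp0m a b c (f : chom a b) : (0 : chom b c) \oC f = 0.
Proof. exact: (raddf0 (precomp f)). Qed.
Lemma compm0 a b c (g : chom b c) : g \oC (0 : chom a b) = 0.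
Proof. exact: (raddf0 (postcomp g)). Qed.
Lemma compDl a b c (g h : chom b c) (f : chom a b) :
  (g + h) \oC f = (g \oC f) + (h \oC f).
Proof. exact: (raddfD (precomp f)). Qed.
Lemma compBl a b c (g h : chom b c) (f : chom a b) :
  (g - h) \oC f = (g \oC f) - (h \oC f).
Proof. exact: (raddfB (precomp f)). Qed.
Lemma compDr a b c (g : chom b c) (f h : chom a b) :
  g \oC (f + h) = (g \oC f) + (g \oC h).
Proof. exact: (raddfD (postcomp g)). Qed.
Lemma compBr a b c (g : chom b c) (f h : chom a b) :
  g \oC (f - h) = (g \oC f) - (g \oC h).
Proof. exact: (raddfB (postcomp g)). Qed.
Lemma comp_suml a b c n (g : 'I_n -> chom b c) (f : chom a b) :
  (\sum_i g i) \oC f = \sum_i (g i \oC f).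
Proof. exact: (raddf_sum (precomp f)). Qed.
Lemma comp_sumr a b c n (g : chom b c) (f : 'I_n -> chom a b) :
  g \oC (\sum_i f i) = \sum_i (g \oC f i).
Proof. exact: (raddf_sum (postcomp g)). Qed.

Lemma split_mono a b (i : chom a b) p : p \oC i = cidm a -> is_mono i.
Proof.
by move=> pi c g h e; rewrite -[g]ccomp1m -[h]ccomp1m -pi -!ccompA e.
Qed.

Lemma split_epi a b (i : chom a b) p : p \oC i = cidm a -> is_epi p.
Proof.
by move=> pi c g h e; rewrite -[g]ccompm1 -[h]ccompm1 -pi !ccompA e.
Qed.

Lemma zero_objP z : cidm z = 0 -> is_zero_obj z.
Proof.
by move=> z0 c; split=> f; [rewrite -[f]ccompm1|rewrite -[f]ccomp1m];
  rewrite z0 (compm0, comp0m).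
Qed.

(** The two mixed composites vanish as a consequence, see [biproduct_mixed]. *)
Definition is_biproduct c1 c2 c (i1 : chom c1 c) (p1 : chom c c1)
    (i2 : chom c2 c) (p2 : chom c c2) : Prop :=
  [/\ p1 \oC i1 = cidm c1, p2 \oC i2 = cidm c2 &
      (i1 \oC p1) + (i2 \oC p2) = cidm c].

Lemma biproduct_sym c1 c2 c (i1 : chom c1 c) p1 (i2 : chom c2 c) p2 :
  is_biproduct i1 p1 i2 p2 -> is_biproduct i2 p2 i1 p1.
Proof. by case=> pi1 pi2 ip; split; rewrite // addrC. Qed.

Lemma biproduct_mixed c1 c2 c (i1 : chom c1 c) p1 (i2 : chom c2 c) p2 :
  is_biproduct i1 p1 i2 p2 -> p2 \oC i1 = 0.
Proof.
case=> pi1 pi2 ip; apply: (split_mono pi2).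
rewrite compm0 ccompA -[i2 \oC p2](addKr (i1 \oC p1)) ip addrC compBl.
by rewrite ccomp1m -ccompA pi1 ccompm1 subrr.
Qed.

Lemma biproduct_cokernel c1 c2 c (i1 : chom c1 c) p1 (i2 : chom c2 c) p2 :
  is_biproduct i1 p1 i2 p2 -> is_cokernel i2 p1.
Proof.
move=> bip; have [pi1 _ ip] := bip.
split=> [|d g gi2]; first exact: biproduct_mixed (biproduct_sym bip).
have gip : g \oC i1 \oC p1 = g.
  rewrite -[RHS]ccompm1 -ip compDr (ccompA g i2) gi2 comp0m addr0.
  by rewrite ccompA.
exists (g \oC i1); split=> // u up.
by apply: (split_epi pi1); rewrite up.
Qed.

(** Indexing by [option 'I_n] turns the case distinction on [unlift ord0 i]
    into a match with the right dependent types. *)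
Definition ocons n c1 (S : 'I_n -> C) (u : option 'I_n) : C :=
  if u is Some j then S j else c1.

Lemma direct_sum_cons n (S : 'I_n -> C) c1 c' c
    (i1 : chom c1 c) p1 (i2 : chom c' c) p2 :
  is_biproduct i1 p1 i2 p2 -> is_direct_sum S c' ->
  is_direct_sum (fun i => ocons c1 S (unlift ord0 i)) c.
Proof.
move=> bip [inj [proj [projK orth full]]].
have [pi1 pi2 ip] := bip.
have p2i1 := biproduct_mixed bip.
have p1i2 := biproduct_mixed (biproduct_sym bip).
pose inj' u : chom (ocons c1 S u) c :=
  if u is Some j then i2 \oC inj j else i1.
pose proj' u : chom c (ocons c1 S u) :=
  if u is Some j then proj j \oC p2 else p1.
exists (fun i => inj' (unlift ord0 i)), (fun i => proj' (unlift ord0 i)).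
split=> [i|i j neq_ij|].
- case: (unlift ord0 i) => [j|] //=.
  by rewrite -ccompA (ccompA p2) pi2 ccomp1m projK.
- have: unlift ord0 i != unlift ord0 j.
    apply: contra neq_ij; case: unliftP => [i' ->|->];
      by case: unliftP => [j' ->|->] //= /eqP[->].
  case: (unlift ord0 i) (unlift ord0 j) => [i'|] [j'|] //= neq.
  + by rewrite -ccompA (ccompA p2) pi2 ccomp1m orth.
  + by rewrite ccompA p1i2 comp0m.
  + by rewrite -ccompA p2i1 compm0.
- rewrite -ip big_ord_recl unlift_none /=; congr (_ + _).
  under eq_bigr => j _ do rewrite liftK /= -ccompA (ccompA (inj j)).
  by rewrite -comp_sumr -comp_suml full ccomp1m.
Qed.

Definition jointly_epi n (S : 'I_n -> C) c (t : forall j, chom (S j) c) :=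
  forall d (g : chom c d), (forall j, g \oC t j = 0) -> g = 0.

(** * Von Neumann regular morphisms *)

Section Regular.
Hypothesis regular : forall b c (f : chom b c),
  exists h : chom c b, f \oC h \oC f = f.
Hypothesis split_idem : forall c (e : chom c c), e \oC e = e ->
  exists d (i : chom d c) (p : chom c d), p \oC i = cidm d /\ i \oC p = e.

Lemma regular_mono b c (f : chom b c) :
  is_mono f -> exists h : chom c b, h \oC f = cidm b.
Proof.
move=> mono_f; have [h fhf] := regular f; exists h.
by apply: mono_f; rewrite ccompA fhf ccompm1.
Qed.

Lemma regular_epi b c (f : chom b c) :
  is_epi f -> exists h : chom c b, f \oC h = cidm c.
Proof.
move=> epi_f; have [h fhf] := regular f; exists h.
by apply: epi_f; rewrite fhf ccomp1m.
Qed.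

Lemma idem_compl c (e : chom c c) :
  e \oC e = e -> (cidm c - e) \oC (cidm c - e) = cidm c - e.
Proof.
by move=> ee; rewrite compBl ccomp1m compBr ccompm1 ee subrr subr0.
Qed.

(** The kernel is the splitting of the idempotent [1 - h f]. *)
Lemma has_kernel b c (f : chom b c) : exists k (i : chom k b), is_kernel f i.
Proof.
have [h fhf] := regular f.
have hfI : (h \oC f) \oC (h \oC f) = h \oC f by rewrite -ccompA (ccompA f) fhf.
have [k [i [p [pi ip]]]] := split_idem (idem_compl hfI).
exists k, i; split.
  apply: (split_epi pi); rewrite comp0m -ccompA ip.
  by rewrite compBr ccompm1 ccompA fhf subrr.
move=> a g fg; exists (p \oC g); split.
  by rewrite ccompA ip compBl ccomp1m -ccompA fg compm0 subr0.
by move=> u iu; apply: (split_mono pi); rewrite iu ccompA ip compBl ccomp1m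
  -ccompA fg compm0 subr0.
Qed.

(** The cokernel is the splitting of the idempotent [1 - f h]. *)
Lemma has_cokernel b c (f : chom b c) :
  exists q (p : chom c q), is_cokernel f p.
Proof.
have [h fhf] := regular f.
have fhI : (f \oC h) \oC (f \oC h) = f \oC h by rewrite ccompA fhf.
have [q [i [p [pi ip]]]] := split_idem (idem_compl fhI).
exists q, p; split.
  apply: (split_mono pi); rewrite compm0 ccompA ip.
  by rewrite compBl ccomp1m fhf subrr.
move=> a g gf.
have gip : g \oC i \oC p = g.
  by rewrite -ccompA ip compBr ccompm1 ccompA gf comp0m subr0.
exists (g \oC i); split=> // u up.
by apply: (split_epi pi); rewrite up gip.
Qed.

Lemma split_mono_kernel b c (f : chom b c) h :
  h \oC f = cidm b -> is_kernel (cidm c - (f \oC h)) f.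
Proof.
move=> hf; split; first by rewrite compBl ccomp1m -ccompA hf ccompm1 subrr.
move=> a g; rewrite compBl ccomp1m -ccompA => /subr0_eq g_fhg.
exists (h \oC g); split=> // u fu.
by apply: (split_mono hf); rewrite fu.
Qed.

Lemma split_epi_cokernel b c (f : chom b c) h :
  f \oC h = cidm c -> is_cokernel (cidm b - (h \oC f)) f.
Proof.
move=> fh; split; first by rewrite compBr ccompm1 ccompA fh ccomp1m subrr.
move=> a g; rewrite compBr ccompm1 ccompA => /subr0_eq g_ghf.
exists (g \oC h); split=> // u uf.
by apply: (split_epi fh); rewrite uf.
Qed.

Lemma regular_projective c : is_projective c.
Proof.
move=> a b e f /regular_epi[h eh]; exists (h \oC f).
by rewrite ccompA eh ccomp1m.
Qed.

Lemma has_zero_obj (c : C) : exists z : C, is_zero_obj z.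
Proof.
have [z [i [p [pi ip]]]] := split_idem (@compm0 c c c 0).
exists z; apply: zero_objP; apply: (split_mono pi).
by rewrite compm0; apply: (split_epi pi); rewrite comp0m ccompm1 ip.
Qed.

Lemma split_mono_biproduct c1 c (i1 : chom c1 c) p1 :
  p1 \oC i1 = cidm c1 ->
  exists c' (i2 : chom c' c) (p2 : chom c c'), is_biproduct i1 p1 i2 p2.
Proof.
move=> pi1; have ipI : (i1 \oC p1) \oC (i1 \oC p1) = i1 \oC p1.
  by rewrite ccompA -(ccompA i1) pi1 ccompm1.
have [c' [i2 [p2 [pi2 ip2]]]] := split_idem (idem_compl ipI).
by exists c', i2, p2; split=> //; rewrite ip2 addrC subrK.
Qed.

Section Sums.
Variable c0 : C.
Hypothesis biproducts : forall c1 c2 : C,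
  exists c (i1 : chom c1 c) p1 (i2 : chom c2 c) p2, is_biproduct i1 p1 i2 p2.

Lemma has_direct_sum n (S : 'I_n -> C) : exists c, is_direct_sum S c.
Proof.
elim: n S => [|n IHn] S.
  have [z z0] := has_zero_obj c0; exists z.
  exists (fun i => 0), (fun i => 0); split=> [[]//|[]//|].
  by rewrite big_ord0 [cidm z](z0 z).1.
have [c' sum_c'] := IHn (S \o lift ord0).
have [c [i1 [p1 [i2 [p2 bip]]]]] := biproducts (S ord0) c'.
exists c; have := direct_sum_cons bip sum_c'.
suff -> : (fun i => ocons (S ord0) (S \o lift ord0) (unlift ord0 i)) = S by [].
by apply/funext => i; case: unliftP => [j ->|->].
Qed.

Lemma regular_abelian : abelian_cat C.
Proof.
split; [exact: has_direct_sum | exact: has_kernel | exact: has_cokernel | |].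
- move=> k b i /regular_mono[h hi].
  by exists b, (cidm b - (i \oC h)); apply: split_mono_kernel.
- move=> c q p /regular_epi[h ph].
  by exists c, (cidm c - (h \oC p)); apply: split_epi_cokernel.
Qed.

(** A jointly epic family assembles to an epimorphism from the direct sum,
    and a section of it has the required components. *)
Lemma jointly_epi_section n (S : 'I_n -> C) c (t : forall j, chom (S j) c) :
  jointly_epi t ->
  exists phi : forall j, chom c (S j), \sum_j (t j \oC phi j) = cidm c.
Proof.
move=> epi_t; have [b [inj [proj [projK orth full]]]] := has_direct_sum S.
pose f := \sum_j (t j \oC proj j).
have f_inj j : f \oC inj j = t j.
  rewrite comp_suml (bigD1 j) //= -ccompA projK ccompm1 big1 ?addr0 // => i neq.
  by rewrite -ccompA orth ?compm0 // eq_sym.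
have [h fhf] := regular f; exists (fun j => proj j \oC h).
under eq_bigr => j _ do rewrite ccompA.
rewrite -comp_suml; apply/subr0_eq/epi_t => j.
by rewrite compBl ccomp1m -f_inj ccompA fhf subrr.
Qed.

End Sums.

(** * Semisimplicity from simple generators *)

(** The kernel of [t] is not all of [s], hence zero; so [t] is a monomorphism,
    and monomorphisms split. *)
Lemma simple_nonzero_split s c (t : chom s c) :
  is_simple s -> t != 0 -> exists h : chom c s, h \oC t = cidm s.
Proof.
move=> [_ simple_s] t_neq0; have [k [i [ti ker_i]]] := has_kernel t.
have mono_i : is_mono i.
  move=> a g h igh; have [|u [_ uniq_u]] := ker_i a (i \oC g).
    by rewrite ccompA ti comp0m.
  by rewrite -(uniq_u g) // (uniq_u h).
have [k0|[j [ji ij]]] := simple_s k i mono_i; last first.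
  by case/eqP: t_neq0; rewrite -[t]ccompm1 -ij ccompA ti comp0m.
apply: regular_mono => a g h tgh; apply: subr0_eq.
have [|u [<- _]] := ker_i a (g - h); first by rewrite compBr tgh subrr.
by rewrite [u](k0 a).2 compm0.
Qed.

Lemma simple_nonzero_iso s s' (t : chom s s') :
  is_simple s -> is_simple s' -> t != 0 -> is_iso t.
Proof.
move=> ss ss' /(simple_nonzero_split ss)[h /split_mono/ss'.2[]] //.
by case: ss.
Qed.

Variables (n : nat) (S : 'I_n -> C).
Hypothesis simple_S : forall i, is_simple (S i).

(** This is [jointly_epi] for a sequence of morphisms, from which generators
    can be removed one at a time. *)
Definition spans c (l : seq {i : 'I_n & chom (S i) c}) : Prop :=
  forall d (g : chom c d), (forall t, t \in l -> g \oC tagged t = 0) -> g = 0.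

Hypothesis spanned : forall c, exists l, @spans c l.

Lemma simple_classes s : is_simple s -> exists i, isomorphic s (S i).
Proof.
move=> ss; have [l span_l] := spanned s.
have [/hasP[[i t] _ /= t_neq0]|/hasPn all0] :=
  boolP (has (fun t : {i : 'I_n & chom (S i) s} => tagged t != 0) l).
  have [g [gt tg]] := simple_nonzero_iso (simple_S i) ss t_neq0.
  by exists i, g, t.
case: ss => -[]; apply/zero_objP/span_l => t /all0; rewrite negbK => /eqP->.
exact: compm0.
Qed.

(** Induction on the number of generators: a nonzero morphism from a simple
    object splits, and its complement is spanned by the projections of the
    remaining ones. *)
Lemma spanned_ind (P : C -> Prop) :
  (forall z, is_zero_obj z -> P z) ->
  (forall s c' c (i1 : chom s c) p1 (i2 : chom c' c) p2,
     is_simple s -> is_biproduct i1 p1 i2 p2 -> P c' -> P c) ->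
  forall c, P c.
Proof.
move=> P0 PS c; have [l] := spanned c.
have [m] := ubnP (size l); elim: m c l => // m IHm c [|[i t] l] lt_lm span_l.
  by apply/P0/zero_objP/span_l.
have [t0|t_neq0] := eqVneq t 0.
  apply: (IHm c l) => // d g gl; apply: span_l => t'.
  by rewrite inE => /orP[/eqP->|/gl//]; rewrite /= t0 compm0.
have [h ht] := simple_nonzero_split (simple_S i) t_neq0.
have [c' [i2 [p2 bip]]] := split_mono_biproduct ht.
apply: (PS _ _ _ _ _ _ _ (simple_S i) bip).
pose push (u : {i : 'I_n & chom (S i) c}) : {i : 'I_n & chom (S i) c'} :=
  Tagged (fun i => chom (S i) c') (p2 \oC tagged u).
apply: (IHm c' (map push l)); first by rewrite size_map.
move=> d g g0; have [_ pi2 _] := bip.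
apply: (split_epi pi2); rewrite comp0m; apply: span_l => u.
rewrite inE => /orP[/eqP->|ul] /=.
  by rewrite -ccompA (biproduct_mixed bip) compm0.
by rewrite -ccompA; apply: (g0 (push u)); apply: map_f.
Qed.

Lemma spanned_semisimple : semisimple_cat C.
Proof.
apply: spanned_ind => [z z0|s c' c i1 p1 i2 p2 ss bip].
  exists 0, (fun i => z); split=> [[]//|].
  exists (fun i => 0), (fun i => 0); split=> [[]//|[]//|].
  by rewrite big_ord0 [cidm z](z0 z).1.
move=> [m [T [simple_T sumT]]].
exists m.+1, (fun i => ocons s T (unlift ord0 i)); split.
  by move=> i; case: (unlift ord0 i).
exact: direct_sum_cons bip sumT.
Qed.

Lemma spanned_finite_length c : finite_length c.
Proof.
elim/spanned_ind: c => [|s c' c i1 p1 i2 p2 ss bip].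
  exact: finite_length0.
move=> len; have [pi1 pi2 ip] := bip.
exact: finite_lengthS len (split_mono pi2) (biproduct_cokernel bip) ss.
Qed.

End Regular.
End Preadditive.

(** * Submodules and finite generation *)

Section Submodules.
Variables (R : pzRingType) (V : lmodType R).
Implicit Types (N : V -> Prop) (x y : V).

Definition submodule N : Prop :=
  N 0 /\ forall a x y, N x -> N y -> N (a *: x + y).

Variables (N : V -> Prop) (sN : submodule N).

Lemma submodule0 : N 0. Proof. exact: sN.1. Qed.
Lemma submoduleD x y : N x -> N y -> N (x + y).
Proof. by move=> Nx Ny; rewrite -[x]scale1r; apply: sN.2. Qed.
Lemma submoduleZ a x : N x -> N (a *: x).
Proof.
by move=> Nx; rewrite -[a *: x]addr0; apply: sN.2 => //; apply: sN.1.
Qed.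
Lemma submoduleB x y : N x -> N y -> N (x - y).
Proof.
by move=> Nx Ny; apply: submoduleD => //; rewrite -scaleN1r; apply: submoduleZ.
Qed.
Lemma submodule_sum I (r : seq I) (P : pred I) (F : I -> V) :
  (forall i, P i -> N (F i)) -> N (\sum_(i <- r | P i) F i).
Proof.
by move=> NF; elim/big_ind: _ => //; [exact: submodule0 | exact: submoduleD].
Qed.

End Submodules.

(** This form of finite generation replaces computations with coefficients by
    an induction principle. *)
Lemma fin_genP (R : pzRingType) (V : lmodType R) :
  fin_gen V <-> exists s : seq V, forall N, submodule N ->
    (forall x, x \in s -> N x) -> forall v, N v.
Proof.
split=> -[s gen]; exists s.
  move=> N sN Ns v; have [c ->] := gen v.
  by apply: submodule_sum => // i _; apply: submoduleZ => //; apply/Ns/mem_nth.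
apply: gen => [|x xs].
  split; first by exists (fun=> 0); rewrite big1 // => i _; rewrite scale0r.
  move=> a x y [c ->] [d ->]; exists (fun i => a * c i + d i).
  rewrite scaler_sumr -big_split; apply: eq_bigr => i _ /=.
  by rewrite scalerDl scalerA.
have xi : (index x s < size s)%N by rewrite index_mem.
exists (fun i => (i == Ordinal xi)%:R).
rewrite (bigD1 (Ordinal xi)) //= eqxx scale1r nth_index // big1 ?addr0 //.
by move=> i /negPf->; rewrite scale0r.
Qed.

Lemma fin_gen_image (R : pzRingType) (V W : lmodType R) (f : {linear V -> W}) :
  (forall w, exists v, f v = w) -> fin_gen V -> fin_gen W.
Proof.
move=> surj_f /fin_genP[s gen]; apply/fin_genP; exists (map f s).
move=> N sN Ns w; have [v <-] := surj_f w.
apply: (gen (fun v => N (f v))) => [|x xs]; last exact/Ns/map_f.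
split; first by rewrite linear0; apply: submodule0.
by move=> a x y; rewrite linearP; apply: sN.2.
Qed.

Lemma fin_gen_pair (R : pzRingType) (V W : lmodType R) :
  fin_gen V -> fin_gen W -> fin_gen (V * W)%type.
Proof.
move=> /fin_genP[s genV] /fin_genP[t genW]; apply/fin_genP.
exists ([seq (v, 0) | v <- s] ++ [seq (0, w) | w <- t]) => N sN Nst [v w].
rewrite [(v, w)](_ : _ = (v, 0) + (0, w)); last first.
  by congr pair; rewrite /= (addr0, add0r).
apply: submoduleD => //.
  apply: (genV (fun v => N (v, 0))) => [|x xs]; last first.
    by apply: Nst; rewrite mem_cat map_f.
  split=> [|a x y Nx Ny]; first exact: submodule0 sN.
  have -> : (a *: x + y, 0) = a *: (x, 0) + (y, 0) :> V * W; last exact: sN.2.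
  by congr pair; rewrite /= scaler0 addr0.
apply: (genW (fun w => N (0, w))) => [|x xs]; last first.
  by apply: Nst; rewrite mem_cat map_f ?orbT.
split=> [|a x y Nx Ny]; first exact: submodule0 sN.
have -> : (0, a *: x + y) = a *: (0, x) + (0, y) :> V * W; last exact: sN.2.
by congr pair; rewrite /= scaler0 addr0.
Qed.

Section Fixed.
Variables (R : pzRingType) (M : lmodType R) (e : {linear M -> M}).

Definition fixed : {pred M} := fun x => e x == x.

Fact fixed_closed : GRing.submod_closed fixed.
Proof.
split=> [|a x y /eqP ex /eqP ey]; apply/eqP; first exact: linear0.
by rewrite linearP ex ey.
Qed.

HB.instance Definition _ := GRing.isSubmodClosed.Build R M fixed fixed_closed.

(** When [e] is idempotent, this is the image of [e]. *)
Record fixed_mod := FixedMod { fixed_val : M; _ : fixed_val \in fixed }.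

HB.instance Definition _ := [isSub for fixed_val].
HB.instance Definition _ := [Choice of fixed_mod by <:].
HB.instance Definition _ := [SubChoice_isSubLmodule of fixed_mod by <:].

Lemma fixedP (u : fixed_mod) : e (fixed_val u) = fixed_val u.
Proof. by apply/eqP; case: u. Qed.

End Fixed.

(** * The category of finitely generated modules *)

Section Modules.
Variables (K : comPzRingType) (A : unital_alg K).
Implicit Types L M N P : fgmod A.

Lemma split_idem_fgmod M (e : Hom M M) : (forall x, e (e x) = e x) ->
  exists D : fgmod A, exists (i : Hom D M) (p : Hom M D),
    (forall u, p (i u) = u) /\ (forall x, i (p x) = e x).
Proof.
move=> ee.
pose D0 : lmodType A := fixed_mod e.
have i_lin : linear (@fixed_val A M e : D0 -> M) by move=> a x y.
have e_fix x : e x \in fixed e by apply/eqP/ee.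
pose p0 x : D0 := FixedMod (e_fix x).
have p_lin : linear p0 by move=> a x y; apply: val_inj; rewrite /= linearP.
pose i := mkHom i_lin; pose p := mkHom p_lin.
have pi u : p (i u) = u by apply: val_inj; rewrite /= fixedP.
have fgD : fin_gen D0.
  by apply: (fin_gen_image (f := p)) (fgmodP M) => u; exists (i u).
by exists (FgMod fgD), i, p.
Qed.

Lemma fgmod_biproduct M N : exists P : fgmod_cat A,
  exists (i1 : chom (M : fgmod_cat A) P) p1 (i2 : chom (N : fgmod_cat A) P) p2,
    is_biproduct i1 p1 i2 p2.
Proof.
have l1 : linear (fun x : M => (x, 0) : M * N).
  by move=> a x y; congr pair; rewrite /= scaler0 addr0.
have l2 : linear (fun y : N => (0, y) : M * N).
  by move=> a x y; congr pair; rewrite /= scaler0 addr0.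
have r1 : linear (fun u : M * N => u.1) by [].
have r2 : linear (fun u : M * N => u.2) by [].
exists (FgMod (fin_gen_pair (fgmodP M) (fgmodP N))).
exists (mkHom l1), (mkHom r1), (mkHom l2), (mkHom r2).
split; apply: HomP => // -[x y].
by congr pair; rewrite /= ?addr0 ?add0r.
Qed.

Lemma regular_fin_gen : fin_gen A^o.
Proof.
apply/fin_genP; exists [:: 1] => N sN N1 v.
by rewrite -[v]mulr1; apply: (submoduleZ sN v); apply: N1; rewrite inE.
Qed.

Definition regular_fgmod : fgmod A := FgMod regular_fin_gen.

Lemma orbit_linear (M : lmodType A) (m : M) :
  linear (fun a : A^o => (a : A) *: m).
Proof. by move=> a x y; rewrite scalerDl scalerA. Qed.

Definition orbit_map (M : lmodType A) (m : M) : Hom A^o M :=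
  mkHom (orbit_linear m).

(** * Complements and regularity over a semisimple algebra *)

Section Semisimple.
(** [e i] is the component in [S i] of the unit of [A], see
    [semisimple_idempotents]. *)
Variables (n : nat) (S : 'I_n -> {pred A^o}) (e : 'I_n -> A).
Hypothesis simple_S : forall i, simple_submod (S i).
Hypothesis e_in : forall i a, (a * e i : A^o) \in S i.
Hypothesis e_fix : forall i (a : A^o), a \in S i -> (a : A) * e i = a.
Hypothesis e_sum : \sum_i e i = 1.

(** The complement is a sum of some of the finitely many submodules
    [S i *: m], with [m] a generator of [M]. Each of these in turn either lies
    in the sum of [N] and the part [D] built so far, or meets it in zero, by
    simplicity of [S i]; in the latter case it is added to [D]. *)
Lemma complement M (N : M -> Prop) : submodule N ->
  exists D : M -> Prop, [/\ submodule D, forall x, N x -> D x -> x = 0 &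
    forall v, exists x y, [/\ N x, D y & v = x + y]].
Proof.
move=> sN; have /fin_genP[s gen] := fgmodP M.
pose sum (D : M -> Prop) v := exists x y, [/\ N x, D y & v = x + y].
have sum_sub D : submodule D -> submodule (sum D).
  move=> sD; split.
    exists 0, 0; split; last by rewrite addr0.
      exact: submodule0.
    exact: submodule0.
  move=> a _ _ [x [y [Nx Dy ->]]] [x' [y' [Nx' Dy' ->]]].
  exists (a *: x + x'), (a *: y + y').
  by split; [exact: sN.2 | exact: sD.2 | rewrite scalerDr addrACA].
have sumD D x : D x -> sum D x.
  by move=> Dx; exists 0, x; split=> //; [exact: submodule0 | rewrite add0r].
suff [D [sD ND full]] : exists D : M -> Prop,
    [/\ submodule D, forall x, N x -> D x -> x = 0 &
    forall im, im \in [seq (i, m) | i <- enum 'I_n, m <- s] ->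
    forall a, a \in S im.1 -> sum D ((a : A) *: im.2)].
  exists D; split=> //; apply: gen; first exact: sum_sub.
  move=> m ms; rewrite -[m]scale1r -e_sum scaler_suml.
  apply: (submodule_sum (sum_sub D sD)) => i _.
  apply: (full (i, m)); last by rewrite /= -[e i]mul1r.
  by apply/allpairsP; exists (i, m); rewrite mem_enum.
elim: [seq _ | i <- _, m <- _] => [|[i m] l [D [sD ND full]]].
  exists (fun x => x = 0); split=> //.
  by split=> // a x y -> ->; rewrite scaler0 addr0.
have [sub0 _ minS] := simple_S i.
have sS := sub0.2; have S0 := sub0.1.
pose T : {pred A^o} := fun a => (a \in S i) && `[< sum D ((a : A) *: m) >].
have subT : GRing.submod_closed T.
  split.
    apply/andP; split=> //; apply/asboolP; rewrite scale0r.
    exact: submodule0 (sum_sub D sD).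
  move=> b x y /andP[Sx /asboolP Dx] /andP[Sy /asboolP Dy].
  apply/andP; split; first exact: sS.
  by apply/asboolP; rewrite scalerDl -scalerA; apply: (sum_sub D sD).2.
have [|T0|TS] := minS T subT; first by move=> a /andP[].
  pose D' v := exists x a, [/\ D x, a \in S i & v = x + (a : A) *: m].
  have sD' : submodule D'.
    split.
      by exists 0, 0; split=> //; [exact: submodule0 | rewrite scale0r addr0].
    move=> b _ _ [x [a [Dx Sa ->]]] [x' [a' [Dx' Sa' ->]]].
    exists (b *: x + x'), (b *: a + a'); split; [exact: sD.2|exact: sS|].
    by rewrite scalerDr addrACA scalerDl scalerA.
  exists D'; split=> //.
    move=> v Nv [x [a [Dx Sa vE]]].
    have /eqP a0 : a \in pred1 0.
      rewrite -T0; apply/andP; split=> //; apply/asboolP.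
      have -> : (a : A) *: m = v + - x by rewrite vE addrAC subrr add0r.
      exists v, (- x); split=> //; rewrite -[- x]add0r.
      by apply: submoduleB => //; apply: submodule0.
    by apply: ND => //; rewrite vE a0 scale0r addr0.
  have DD' x : D x -> D' x.
    by move=> Dx; exists x, 0; rewrite scale0r addr0.
  move=> [j p]; rewrite inE => /orP[/eqP[-> ->] a Sa|jp a Sa] /=.
    apply: sumD; exists 0, a; split=> //; last by rewrite add0r.
    exact: submodule0.
  have [x [y [Nx Dy ->]]] := full _ jp a Sa.
  by exists x, y; split=> //; apply: DD'.
exists D; split=> // -[j p]; rewrite inE => /orP[/eqP[-> ->] a /= Sa|/full//].
by have := Sa; rewrite -TS => /andP[_ /asboolP].
Qed.

Lemma projector M (N : M -> Prop) : submodule N ->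
  exists p : Hom M M, (forall x, N (p x)) /\ (forall x, N x -> p x = x).
Proof.
move=> sN; have [D [sD ND full]] := complement sN.
have /choice[p pP] : forall v, exists x, N x /\ D (v - x).
  move=> v; have [x [y [Nx Dy ->]]] := full v.
  by exists x; rewrite addrAC subrr add0r.
have p_uniq v x : N x -> D (v - x) -> p v = x.
  move=> Nx Dx; have [Np Dp] := pP v; apply: subr0_eq; apply: ND.
    exact: submoduleB.
  have -> : p v - x = (v - x) - (v - p v) by rewrite opprB [RHS]addrC subrKA.
  exact: submoduleB.
have p_lin : linear p.
  move=> a x y; have [[Nx Dx] [Ny Dy]] := (pP x, pP y).
  apply: p_uniq; first exact: sN.2.
  by rewrite opprD addrACA -scalerBr; apply: sD.2.
exists (mkHom p_lin); split=> [x|x Nx]; first exact: (pP x).1.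
by apply: p_uniq => //; rewrite subrr; apply: submodule0.
Qed.

(** With [q] and [r] projectors onto the kernel and the image of [f], the map
    [h] sends [y] to the preimage of [r y] that [q] annihilates. *)
Lemma Hom_regular M N (f : Hom M N) :
  exists h : Hom N M, forall x, f (h (f x)) = f x.
Proof.
have [|q [ker_q q_fix]] := @projector M (fun x => f x = 0).
  by split=> [|a x y fx fy]; rewrite ?linear0 // linearP fx fy scaler0 addr0.
have [|r [im_r r_fix]] := @projector N (fun y => exists x, f x = y).
  split=> [|a _ _ [x <-] [y <-]]; first by exists 0; rewrite linear0.
  by exists (a *: x + y); rewrite linearP.
have [g gP] := choice im_r.
(* So the value of [h] does not depend on the preimage chosen by [g], and [h]
   is linear although [g] need not be. *)
have q_compl u w : f u = f w -> u - q u = w - q w.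
  move=> fuw; have fd0 : f (u - w) = 0 by rewrite linearB fuw subrr.
  rewrite -[u](subrK w) (linearD q) (q_fix _ fd0).
  by rewrite opprD addrACA subrr add0r.
have h_lin : linear (fun y => g y - q (g y)).
  move=> a y y'; rewrite (q_compl _ (a *: g y + g y')).
    by rewrite linearP scalerBr opprD addrACA.
  by rewrite linearP !gP linearP.
exists (mkHom h_lin) => x.
rewrite mkHomE linearB ker_q subr0 gP r_fix //.
by exists x.
Qed.

(** * Generation by simple objects *)

(** The ideal [S i] is realized as the image of right multiplication by [e i].
    The image of a monomorphism into it is a submodule of [S i]: either zero, or
    all of [S i], and then the left inverse provided by regularity is also a
    right inverse. *)
Lemma simple_ideal_fgmod i : exists D : fgmod A,
  is_simple (D : fgmod_cat A) /\
  exists inc : Hom D A^o, exists u, inc u = e i.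
Proof.
have e_idem x : orbit_map (e i : A^o) (orbit_map (e i : A^o) x) =
    orbit_map (e i : A^o) x.
  exact/e_fix/e_in.
have [D [inc [p [incK ip]]]] :=
  split_idem_fgmod (M := regular_fgmod) e_idem.
have inc_inj : injective inc := can_inj incK.
have inc_in u : inc u \in S i by rewrite -[u]incK ip; apply: e_in.
have in_inc x : x \in S i -> exists u, inc u = x.
  by move=> Sx; exists (p x); rewrite ip; apply: e_fix.
have [_ [x Sx x_neq0] minS] := simple_S i.
exists D; split; last first.
  by exists inc; apply: in_inc; rewrite -[e i]mul1r.
split=> [D0|d f mono_f].
  have [u xE] := in_inc x Sx; case/eqP: x_neq0.
  have id0 : cidm (D : fgmod_cat A) = 0 by apply: (D0 D).1.
  have := congr1 (fun f : Hom D D => inc (f u)) id0.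
  by rewrite /= xE linear0.
have [h hf] : exists h, h \oC f = cidm d.
  apply: regular_mono mono_f => b c g; have [k gkg] := Hom_regular g.
  by exists k; apply: HomP.
have fK v : h (f v) = v := congr1 (fun g : Hom d d => g v) hf.
pose T : {pred A^o} := fun a => `[< exists v, inc (f v) = a >].
have subT : GRing.submod_closed T.
  split; first by apply/asboolP; exists 0; rewrite !linear0.
  move=> a _ _ /asboolP[v <-] /asboolP[w <-].
  by apply/asboolP; exists (a *: v + w); rewrite !linearP.
have [|T0|TS] := minS T subT; first by move=> _ /asboolP[v <-].
  left; apply/zero_objP/HomP => v.
  suff fv0 : f v = 0 by rewrite -[LHS]fK [in LHS]/= fv0 linear0.
  apply: inc_inj; rewrite linear0; apply/eqP.
  by have := T0 (inc (f v)); rewrite [in RHS]inE => <-; apply/asboolP; exists v.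
right; exists h; split=> //; apply: HomP => u.
have /asboolP[v /inc_inj fv] : inc u \in T by rewrite TS.
by rewrite -fv /= fK.
Qed.

(** The morphisms [a |-> a *: m] on [S i], for [m] in a generating family of
    [M], are jointly epic, as [m] is the sum of the [e i *: m]. *)
Lemma simple_generators : exists D : 'I_n -> fgmod_cat A,
  (forall i, is_simple (D i)) /\ (forall M, exists l, @spans _ _ _ D M l).
Proof.
have /choice[D DP] := simple_ideal_fgmod.
exists D; split=> [i|M]; first exact: (DP i).1.
pose inc i := projT1 (cid (DP i).2).
have incP i : exists u, inc i u = e i := projT2 (cid (DP i).2).
have /fin_genP[s gen] := fgmodP M.
pose t i m : {i : 'I_n & @chom _ (fgmod_cat A) (D i) M} :=
  Tagged (fun i => @chom _ (fgmod_cat A) (D i) M)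
    (Hom_comp (orbit_map m) (inc i)).
exists [seq t i m | i <- enum 'I_n, m <- s].
move=> N g g0; apply: HomP; apply: gen.
  by split=> [|a x y gx gy]; rewrite ?linear0 // linearP gx gy scaler0 addr0.
move=> m ms; rewrite -[m]scale1r -e_sum scaler_suml linear_sum.
apply: big1 => i _; have [u uE] := incP i.
have /g0 : t i m \in [seq t i m | i <- enum 'I_n, m <- s].
  by apply/allpairsP; exists (i, m); rewrite mem_enum.
by move=> /(congr1 (fun f : Hom (D i) N => f u)) /=; rewrite uE.
Qed.

End Semisimple.

(** For [a] in [S i], both [a] itself and the family of the [a * e j] are
    decompositions of [a]; by uniqueness they agree. *)
Lemma semisimple_idempotents : semisimple_alg A ->
  exists n (S : 'I_n -> {pred A^o}) (e : 'I_n -> A),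
  [/\ forall i, simple_submod (S i), forall i a, (a * e i : A^o) \in S i,
      forall i (a : A^o), a \in S i -> (a : A) * e i = a & \sum_i e i = 1].
Proof.
move=> [n [S [simple_S decomp]]].
have [e [[e_in e_sum] _]] := decomp 1.
have sub i := let: And3 sS _ _ := simple_S i in sS.
have aeS i a : (a * e i : A^o) \in S i.
  by have [S0 SL] := sub i; rewrite -[_ * _]addr0; apply: SL.
exists n, S, e; split=> // i a Sa.
have [c [_ c_uniq]] := decomp a.
have c1 : c = [ffun j => (a : A) * e j].
  apply: c_uniq; split=> [j|]; first by rewrite ffunE.
  under eq_bigr => j _ do rewrite ffunE.
  by rewrite -mulr_sumr -e_sum mulr1.
have c2 : c = [ffun j => if j == i then a else 0].
  apply: c_uniq; split=> [j|].
    by rewrite ffunE; case: eqP => [->|_] //; have [] := sub j.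
  rewrite (bigD1 i) //= ffunE eqxx big1 ?addr0 // => j /negPf ji.
  by rewrite ffunE ji.
have := congr1 (fun c : {ffun 'I_n -> A^o} => c i) c1.
by rewrite c2 !ffunE eqxx.
Qed.

Hypothesis ssA : semisimple_alg A.

Lemma fgmod_regular (M N : fgmod_cat A) (f : chom M N) :
  exists h : chom N M, f \oC h \oC f = f.
Proof.
have [n [S [e [simple_S e_in e_fix e_sum]]]] := semisimple_idempotents ssA.
by have [h fhf] := Hom_regular simple_S e_in e_sum f; exists h; apply: HomP.
Qed.

Lemma fgmod_split_idem (M : fgmod_cat A) (e : chom M M) : e \oC e = e ->
  exists D (i : chom D M) (p : chom M D), p \oC i = cidm D /\ i \oC p = e.
Proof.
move=> ee; have [|D [i [p [pi ip]]]] := split_idem_fgmod (e := e).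
  by move=> x; have := congr1 (fun f : Hom M M => f x) ee.
by exists D, i, p; split; apply: HomP.
Qed.

Lemma fgmod_simple_generators : exists n (D : 'I_n -> fgmod_cat A),
  (forall i, is_simple (D i)) /\ (forall M, exists l, @spans _ _ _ D M l).
Proof.
have [n [S [e [simple_S e_in e_fix e_sum]]]] := semisimple_idempotents ssA.
by exists n; apply: simple_generators simple_S e_in e_fix e_sum.
Qed.

(** * Dual bases and finite-dimensionality of morphism spaces *)

(** The maps [a |-> a *: m j], for generators [m j], form an epimorphism from a
    free module; the components of a section of it are the [phi j]. *)
Lemma dual_basis M : exists r (m : 'I_r -> M) (phi : 'I_r -> Hom M A^o),
  forall x, x = \sum_j (phi j x : A) *: m j.
Proof.
have [s gen] := (fin_genP M).1 (fgmodP M).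
pose m (j : 'I_(size s)) := s`_j.
have epi_m : @jointly_epi _ (fgmod_cat A) _ (fun=> regular_fgmod) M
    (fun j => orbit_map (m j)).
  move=> N g g0; apply: HomP; apply: gen.
    by split=> [|a x y gx gy]; rewrite ?linear0 // linearP gx gy scaler0 addr0.
  move=> x xs; have xi : (index x s < size s)%N by rewrite index_mem.
  have := congr1 (fun f : Hom A^o N => f 1) (g0 (Ordinal xi)).
  by rewrite /= scale1r /m /= nth_index.
have [phi phiE] := jointly_epi_section fgmod_regular fgmod_split_idem
  (regular_fgmod : fgmod_cat A) fgmod_biproduct epi_m.
exists (size s), m, phi => x.
rewrite -[LHS]/(cidm (M : fgmod_cat A) x) -phiE.
pose ev0 (f : Hom M M) := f x.
have ev_sum (I : finType) (F : I -> Hom M M) :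
    ev0 (\sum_j F j) = \sum_j ev0 (F j).
  by apply: (big_morph ev0).
exact: ev_sum.
Qed.

(** A spanning family consists of the maps [x |-> (phi j x * a) *: y], where [a]
    and [y] run over finite generating families of [A] over [K] and of [N]
    over [A]. *)
Lemma fgmod_finite_homs M N : fin_gen (vect_of A) -> fin_gen (Hom M N).
Proof.
move=> /fin_genP[sA genA]; have /fin_genP[sN genN] := fgmodP N.
have [r [m [phi phiE]]] := dual_basis M.
pose rank1 j y : Hom M N := Hom_comp (orbit_map y) (phi j).
apply/fin_genP; exists [seq rank1 ja.1 ((ja.2 : A) *: y) |
  ja <- [seq (j, a) | j <- enum 'I_r, a <- sA], y <- sN].
move=> P sP gen f.
suff Prank j y : P (rank1 j y).
  have -> : f = \sum_j rank1 j (f (m j)).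
    apply: HomP => x; rewrite {1}[x]phiE linear_sum.
    have ev_sum (F : 'I_r -> Hom M N) : (\sum_j F j) x = \sum_j F j x.
      by apply: (big_morph (fun f : Hom M N => f x)).
    by rewrite ev_sum; apply: eq_bigr => j _; rewrite linearZ.
  exact: submodule_sum.
have rank1D u v : rank1 j (u + v) = rank1 j u + rank1 j v.
  by apply: HomP => x; rewrite /= scalerDr.
have rank10 : rank1 j 0 = 0 by apply: HomP => x; rewrite /= scaler0.
(* The scalar 1 is generalized so that the induction on [y] is [A]-linear. *)
rewrite -[y]scale1r; move: y (1 : A); apply: genN.
  split=> [a|a x y Px Py b]; first by rewrite scaler0 rank10; apply: submodule0.
  by rewrite scalerDr scalerA rank1D; apply: submoduleD.
move=> y ys; apply: genA => [|a sa]; last first.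
  apply: gen; apply/allpairsP; exists ((j, a), y); split=> //.
  by apply/allpairsP; exists (j, a); rewrite mem_enum.
split=> [|k a b Pa Pb]; first by rewrite scale0r rank10; apply: submodule0.
have -> : rank1 j ((k *: a + b : vect_of A) *: y) =
    k *: rank1 j ((a : A) *: y) + rank1 j ((b : A) *: y).
  apply: HomP => x; rewrite [LHS]/=.
  have -> : ((k *: a + b : vect_of A) : A) *: y =
      alg_in A k *: ((a : A) *: y) + (b : A) *: y.
    by rewrite scalerA -scalerDl.
  by rewrite scalerDr scalerA -alg_inC -scalerA.
exact: sP.2.
Qed.

(** * The trace *)

Variable lam : {scalar (vect_of A)}.
Hypothesis lamC : is_symmetric_form lam.

Section TraceFormula.
Variables (M : fgmod A) (r : nat) (m : 'I_r -> M) (phi : 'I_r -> Hom M A^o).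
Hypothesis phiE : forall x, x = \sum_j (phi j x : A) *: m j.

Definition dual_basis_trace (f : Hom M M) : K := \sum_j lam (phi j (f (m j))).

Lemma dual_basis_trace_linear : scalar dual_basis_trace.
Proof.
move=> k f g; rewrite /dual_basis_trace /= mulr_sumr -big_split.
apply: eq_bigr => j _; rewrite -[RHS]linearP; congr (lam _).
exact: linearP.
Qed.

HB.instance Definition _ :=
  GRing.isLinear.Build K (Hom M M) K *%R dual_basis_trace
    dual_basis_trace_linear.

(** Expand [y] in the dual basis on the right-hand side; the symmetry of [lam]
    then exchanges [g (m j)] and [phi j y]. *)
Lemma dual_basis_trace_comp (g : Hom M A^o) y :
  dual_basis_trace (Hom_comp (orbit_map y) g) = lam (g y).
Proof.
rewrite {2}[y]phiE linear_sum raddf_sum /dual_basis_trace.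
apply: eq_bigr => j _.
by rewrite /= !linearZ lamC.
Qed.

(** The sum over [j] of the tensors of [phi j] with [f (m j)] is a preimage
    of [f]. *)
Lemma Psi_surj f : exists t, Psi t = f :> Hom M M.
Proof.
exists (to_tensor (\sum_j << (phi j : dual M, f (m j)) >>)).
rewrite [LHS](tensor_lift_pi _ (@rank1_balanced _ _ _)).
have fE : f = \sum_j rank1_Hom (phi j) (f (m j)).
  apply: HomP => x; rewrite {1}[x]phiE linear_sum.
  rewrite [RHS](big_morph (fun f : Hom M M => f x) (id1 := 0) (op1 := +%R)) //.
  by apply: eq_bigr => j _; rewrite linearZ.
rewrite [RHS]fE; elim/big_ind2: _ => [|x1 f1 x2 f2 <- <-|j _].
- by rewrite free_liftE raddf0.
- exact: free_liftD.
- exact: free_liftU.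
Qed.

(** [lam (ev t)] and [dual_basis_trace (Psi t)] are additive in the tensor [t]
    and agree on elementary tensors by [dual_basis_trace_comp]. So [Psi_inv f]
    may be replaced by any preimage of [f] under [Psi], and only the existence
    of one matters. *)
Lemma trace_dual_basis f : trace lam f = dual_basis_trace f.
Proof.
have [t tf] := Psi_surj f.
have {2}<- : Psi (Psi_inv f) = f by apply: pinvK; rewrite inE; exists t.
rewrite /trace form_evE /Psi /tensor_lift /free_lift raddf_sum.
apply: eq_bigr => -[g y] _; rewrite raddfMz -dual_basis_trace_comp.
by congr (dual_basis_trace _ *~ _); apply: HomP.
Qed.

End TraceFormula.

Lemma trace_linear M : scalar (@trace K A M lam).
Proof.
have [r [m [phi phiE]]] := dual_basis M.
by move=> k f g; rewrite !(trace_dual_basis phiE) linearP.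
Qed.

Lemma trace_comp_orbit M (g : Hom M A^o) y :
  trace lam (Hom_comp (orbit_map y) g) = lam (g y).
Proof.
have [r [m [phi phiE]]] := dual_basis M.
by rewrite (trace_dual_basis phiE) dual_basis_trace_comp.
Qed.

(** Expanding in dual bases of both [M] and [N] turns either side into the same
    double sum, up to the order of the two factors inside [lam]. *)
Lemma trace_cyclic M N (f : Hom M N) (g : Hom N M) :
  trace lam (Hom_comp g f) = trace lam (Hom_comp f g).
Proof.
have [r [m [phi phiE]]] := dual_basis M.
have [s [n [psi psiE]]] := dual_basis N.
rewrite (trace_dual_basis phiE) (trace_dual_basis psiE) /dual_basis_trace.
have expand_gf j : lam (phi j (g (f (m j)))) =
    \sum_l lam ((psi l (f (m j)) : A) * phi j (g (n l))).
  rewrite {1}[f (m j)]psiE !linear_sum.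
  by apply: eq_bigr => l _; rewrite !linearZ.
have expand_fg l : lam (psi l (f (g (n l)))) =
    \sum_j lam ((phi j (g (n l)) : A) * psi l (f (m j))).
  rewrite {1}[g (n l)]phiE !linear_sum.
  by apply: eq_bigr => j _; rewrite !linearZ.
rewrite (eq_bigr _ (fun j _ => expand_gf j)).
rewrite (eq_bigr _ (fun l _ => expand_fg l)) exchange_big.
by apply: eq_bigr => l _; apply: eq_bigr => j _; rewrite lamC.
Qed.

Hypothesis frob : is_frobenius_form lam.

(** Testing [f] against the rank one maps [y |-> psi l y *: (a *: x)] gives
    [lam (a * psi l (f x)) = 0] for all [a]. *)
Lemma trace_faithful M N (f : Hom M N) :
  (forall g : Hom N M, trace lam (Hom_comp g f) = 0) -> f = 0.
Proof.
move=> f0; have [s [n [psi psiE]]] := dual_basis N.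
apply: HomP => x; rewrite [f x]psiE big1 // => l _.
suff -> : psi l (f x) = 0 by rewrite scale0r.
apply: (proj2 frob) => a.
rewrite -[LHS]/(lam (a *: (psi l (f x) : A^o))) -!linearZ.
rewrite -(trace_comp_orbit (Hom_comp (psi l) f)).
rewrite -[RHS](f0 (Hom_comp (orbit_map (a *: x)) (psi l))).
by congr (trace lam _); apply: HomP.
Qed.

Lemma trace_nondegenerate M N : nondegenerate_pairing
  (fun (f : Hom M N) (g : Hom N M) => trace lam (Hom_comp g f)).
Proof.
split=> [f|g] tr0; first exact: trace_faithful.
by apply: trace_faithful => f; rewrite trace_cyclic.
Qed.

(** * The Calabi-Yau structure *)

Lemma fgmod_abelian : abelian_cat (fgmod_cat A).
Proof.
exact: (regular_abelian fgmod_regular fgmod_split_idem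
  (regular_fgmod : fgmod_cat A) fgmod_biproduct).
Qed.

Lemma fgmod_finite : fin_gen (vect_of A) -> finite_cat (fgmod_cat A).
Proof.
move=> fgA; have [n [D [simple_D span_D]]] := fgmod_simple_generators.
split.
- exists n, D => s simple_s.
  exact: (simple_classes fgmod_regular fgmod_split_idem simple_D span_D).
- move=> M; exists M, (cidm M); split.
    exact: regular_projective fgmod_regular M.
  by move=> N g h; rewrite !ccompm1.
- exact: (spanned_finite_length fgmod_regular fgmod_split_idem simple_D span_D).
- by move=> M N; apply: fgmod_finite_homs.
Qed.

Lemma fgmod_semisimple : semisimple_cat (fgmod_cat A).
Proof.
have [n [D [simple_D span_D]]] := fgmod_simple_generators.
exact: (spanned_semisimple fgmod_regular fgmod_split_idem simple_D span_D).
Qed.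

End Modules.

Theorem proposition3p11 (K : closedFieldType) (A : unital_alg K)
    (lam : {scalar (vect_of A)})
    (hfin : fin_gen (vect_of A))
    (hss : semisimple_alg A)
    (hfrob : is_frobenius_form lam)
    (hsym : is_symmetric_form lam) :
  calabi_yau (C := fgmod_cat A) (fun M : fgmod A => trace (M := M) lam).
Proof.
split.
- exact: fgmod_abelian.
- exact: fgmod_finite.
- exact: fgmod_semisimple.
- exact: trace_linear.
- by move=> M N f g; apply: trace_cyclic.
- by move=> M N; apply: trace_nondegenerate.
Qed.
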